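(* Let $\Sigma>0$ be a fixed positive definite variance-covariance matrix. (1) Suppose $\widehat Q_\Sigma\in\mathcal{G}$ satisfies $$\mathcal{D}_{\widehat Q_\Sigma}(\mu;\Sigma)\le 0\quad\text{for all }\mu\in\Omega.$$ Then $\widehat Q_\Sigma$ is an NPMLE of $Q\in\mathcal{G}$, i.e. it maximizes $l(Q;\Sigma)$ over $Q\in\mathcal{G}$. (2) For such a $\widehat Q_\Sigma$, let $\{\mu_1,\dots,\mu_K\}$, for some $K\le n$, be the solution set $\{\mu\in\Omega:\mathcal{D}_{\widehat Q_\Sigma}(\mu;\Sigma)=0\}$. If the vectors $$\mathbf{f}_{\mu_j}(y;\Sigma)=\{f_{\mu_j}(y_1;\Sigma),\dots,f_{\mu_j}(y_n;\Sigma)\}^T,\qquad j=1,\dots,K,$$ are linearly independent, then $\widehat Q_\Sigma$ is the unique NPMLE of $Q\in\mathcal{G}$.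
   Context: $y_1,\dots,y_n\in\mathbb{R}^p$ are the observed data vectors (distinct, continuous case). $\Omega\subset\mathbb{R}^p$ is the (measurable) parameter space of mean vectors and $\mathcal{G}$ is the set of all probability measures on the Borel subsets of $\Omega$. $f_\mu(\cdot\,;\Sigma)$ is the density of the $p$-dimensional normal distribution with mean $\mu$ and variance-covariance matrix $\Sigma$. For $Q\in\mathcal{G}$, $g_Q(y;\Sigma)=\int_\Omega f_\mu(y;\Sigma)\,dQ(\mu)$ and the loglikelihood is $l(Q;\Sigma)=\sum_{i=1}^n\log g_Q(y_i;\Sigma)$. For fixed $\Sigma$, an NPMLE (nonparametric maximum likelihood estimator) of $Q$ is any maximizer of $l(Q;\Sigma)$ over $Q\in\mathcal{G}$. The gradient function is $$\mathcal{D}_Q(\mu;\Sigma)=\sum_{i=1}^n\left\{\frac{f_\mu(y_i;\Sigma)}{g_Q(y_i;\Sigma)}-1\right\},\qquad\mu\in\Omega.$$ *)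

(* Defs.v *)
From HB Require Import structures.
From mathcomp Require Import all_boot all_order all_algebra.
From mathcomp Require Import all_classical all_reals all_analysis.

Set Implicit Arguments.
Unset Strict Implicit.
Unset Printing Implicit Defensive.

Import Order.TTheory GRing.Theory Num.Theory.
Import numFieldNormedType.Exports.

Local Open Scope classical_set_scope.
Local Open Scope ring_scope.

(* R^p, as column vectors, with its Borel sigma-algebra. *)
Notation borelRp R p := (g_sigma_algebraType (@open 'cV[R]_p)).

Definition posdefmx (R : realType) (p : nat) (S : 'M[R]_p) : Prop :=
  S^T = S /\ forall x : 'cV[R]_p, x != 0 -> 0 < (x^T *m S *m x) 0 0.

Definition mvn_pdf (R : realType) (p : nat) (S : 'M[R]_p) (mu y : 'cV[R]_p) : R :=
  (Num.sqrt ((2 * pi) ^+ p * \det S))^-1 *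
  expR (- ((y - mu)^T *m invmx S *m (y - mu)) 0 0 / 2).

Section mixture.
Context (R : realType) (p n : nat).
Variables (Omega : set (borelRp R p)) (S : 'M[R]_p) (y : 'I_n -> 'cV[R]_p).
Implicit Type Q : probability (borelRp R p) R.

(* A probability measure on the Borel subsets of the Borel set Omega is
   represented by its extension to R^p, which gives Omega mass 1.  A type of
   points of Omega would not do: measurable types are pointed, and Omega may be
   empty. *)
Definition mixing Q : Prop := Q Omega = 1%E.

(* The real-valued integral loses nothing: for positive definite S, the
   integrand is measurable, positive and bounded in mu. *)
Definition mixture_pdf Q (z : 'cV[R]_p) : R :=
  \int[Q]_(mu in Omega) mvn_pdf S mu z.

Definition loglik Q : R := \sum_(i < n) ln (mixture_pdf Q (y i)).

Definition is_NPMLE Q : Prop :=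
  mixing Q /\ forall Q', mixing Q' -> loglik Q' <= loglik Q.

(* Measures are total functions on sets, with unspecified values outside the
   sigma-algebra, so they are compared on measurable sets only. *)
Definition is_unique_NPMLE Q : Prop :=
  is_NPMLE Q /\
  forall Q', is_NPMLE Q' -> forall A, measurable A -> Q' A = Q A.

Definition gradient Q (mu : 'cV[R]_p) : R :=
  \sum_(i < n) (mvn_pdf S mu (y i) / mixture_pdf Q (y i) - 1).

Definition pdf_vec (mu : 'cV[R]_p) : 'cV[R]_n := \col_i mvn_pdf S mu (y i).

End mixture.

(* Main.v *)
Require Import Defs.
From HB Require Import structures.
From mathcomp Require Import all_boot all_order all_algebra.
From mathcomp Require Import all_classical all_reals all_analysis.
From mathcomp Require Import measurable_realfun.

Set Implicit Arguments.
Unset Strict Implicit.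
Unset Printing Implicit Defensive.

Import Order.TTheory GRing.Theory Num.Theory.
Import numFieldNormedType.Exports.

Local Open Scope classical_set_scope.
Local Open Scope ring_scope.

(** Concavity of the logarithm turns both claims into statements about the
integral of the gradient function.  Write g_Q(y_i) for the mixture density, h
for Qhat, and D for the gradient function of h.  For every mixing probability Q,
<<
  l(Q) - l(h) = sum_i ln (g_Q(y_i) / g_h(y_i))
             <= sum_i (g_Q(y_i) / g_h(y_i) - 1) = int D dQ,
>>
by ln x <= x - 1 and the linearity of Q |-> g_Q (loglikB_le_gradient).  If
D <= 0 on Omega, the right-hand side is nonpositive, so h maximizes l.

If Q is another maximizer, then 0 = l(Q) - l(h) <= int D dQ <= 0.  Equality in
ln x <= x - 1 forces g_Q(y_i) = g_h(y_i) for every i (loglikB_eq_gradient), and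
a nonpositive function with integral zero vanishes almost everywhere, so Q, and
likewise h, is carried by the zeros mu_1, ..., mu_K of D (ae_gradient_eq0).  It
remains to recover Q from the numbers g_Q(y_i).  Given a Borel set A, linear
independence of the vectors f_{mu_j} provides weights a_i with
sum_i a_i f_{mu_j}(y_i) = 1_A(mu_j) for every j (free_interpolation).  The
function mu |-> sum_i a_i f_mu(y_i) then agrees with 1_A almost everywhere, both
for Q and for h, so that Q(A) = sum_i a_i g_Q(y_i) = sum_i a_i g_h(y_i) = h(A)
(mixing_mass_lincomb).

All integrals make sense because mu |-> f_mu(z) is Borel, positive and bounded.
Boundedness and positivity rest on two facts about a positive definite S: its
determinant is positive and its inverse is positive semidefinite. *)

(** * Strict concavity of the logarithm at 1 *)

Lemma ln_lt_sub1 (R : realType) (x : R) : 0 < x -> x != 1 -> ln x < x - 1.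
Proof.
move=> x_gt0 x_neq1; rewrite ltrBrDr addrC -[ltRHS](@lnK R x) ?posrE//.
by apply: expR_gt1Dx; rewrite ln_eq0.
Qed.

Lemma ln_le_sub1 (R : realType) (x : R) : 0 < x -> ln x <= x - 1.
Proof.
move=> x_gt0; have [->|/(ln_lt_sub1 x_gt0)/ltW//] := eqVneq x 1.
by rewrite ln1 subrr.
Qed.

(** * Positive definite matrices *)

Lemma trmx_mul_self_gt0 (R : realType) (p : nat) (x : 'cV[R]_p) :
  x != 0 -> 0 < (x^T *m x) 0 0.
Proof.
move=> x_neq0; rewrite mxE lt_neqAle sumr_ge0 ?andbT; last first.
  by move=> i _; rewrite mxE -expr2 sqr_ge0.
apply: contra x_neq0; rewrite eq_sym psumr_eq0 => [/allP x0|i _]; last first.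
  by rewrite mxE -expr2 sqr_ge0.
apply/eqP/colP => i; apply/eqP.
by have := x0 i (mem_index_enum _); rewrite !mxE /= -expr2 sqrf_eq0.
Qed.

(** Otherwise the polynomial t |-> det (t I + (1 - t) S), which is 1 at t = 1,
would vanish somewhere on [0, 1] by the intermediate value theorem, although
positive definite matrices form a convex set and are nonsingular. *)
Lemma posdefmx_det_gt0 (R : realType) (p : nat) (S : 'M[R]_p) :
  posdefmx S -> 0 < \det S.
Proof.
move=> [_ S_pd]; rewrite ltNge; apply/negP => detS_le0.
pose q : {poly R} := \det (('X)%:M + (1 - 'X) *: map_mx polyC S).
have qE t : q.[t] = \det (t%:M + (1 - t) *: S).
  rewrite -horner_evalE -det_map_mx; congr (\det _).
  apply/matrixP => i j; rewrite !mxE /= /horner_eval.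
  by rewrite hornerD hornerM hornerD hornerN hornerMn !hornerC hornerX.
have [|t /andP[t_ge0 t_le1]] := @poly_ivt R q 0 1 ler01.
  rewrite !qE subr0 scale1r subrr scale0r addr0 det1.
  by rewrite raddf0 add0r detS_le0 ler01.
rewrite rootE qE => /det0P[v v_neq0 vA0].
have vT_neq0 : v^T != 0 by rewrite trmx_eq0.
suff : 0 < (v^T^T *m (t%:M + (1 - t) *: S) *m v^T) 0 0.
  by rewrite trmxK vA0 mul0mx mxE ltxx.
rewrite mulmxDr mulmxDl mxE mul_mx_scalar -scalemxAl -scalemxAr -scalemxAl.
rewrite [fun_of_matrix (t *: _) _ _]mxE.
rewrite [fun_of_matrix (_ *: (_ *m _ *m _)) _ _]mxE.
have := trmx_mul_self_gt0 vT_neq0.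
have := S_pd _ vT_neq0.
set a := fun_of_matrix _ _ _; set b := fun_of_matrix _ _ _ => a_gt0 b_gt0.
have [->|t_neq1] := eqVneq t 1.
  by rewrite subrr mul0r addr0 mul1r.
apply: ltr_wpDl; first by rewrite mulr_ge0// ltW.
by rewrite mulr_gt0// subr_gt0 lt_neqAle t_neq1.
Qed.

(** With z = S w the form of the inverse at z is the form of S at w. *)
Lemma posdefmx_invmx_ge0 (R : realType) (p : nat) (S : 'M[R]_p)
  (z : 'cV[R]_p) : posdefmx S -> 0 <= (z^T *m invmx S *m z) 0 0.
Proof.
move=> S_pd; have S_unit : S \in unitmx.
  by rewrite unitmxE unitfE gt_eqF// posdefmx_det_gt0.
have [S_sym S_gt0] := S_pd.
have [w ->] : exists w, z = S *m w.
  by exists (invmx S *m z); rewrite mulKVmx.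
rewrite trmx_mul S_sym mulmxK// mulmxA.
have [->|/S_gt0/ltW//] := eqVneq w 0.
by rewrite mulmx0 mxE.
Qed.

(** * The normal density as a function of its mean *)

Lemma measurable_coord (R : realType) (p : nat) (i : 'I_p) :
  measurable_fun setT (fun mu : borelRp R p => mu i 0).
Proof.
apply: (measurability _ (RGenOpens.measurableE R)) => _ [_ [a [b ->]] <-].
rewrite setTI; apply: sub_sigma_algebra; apply: open_comp => [mu _|].
  exact: coord_continuous.
exact: interval_open.
Qed.

Lemma measurable_mvn_pdf (R : realType) (p : nat) (S : 'M[R]_p)
  (z : 'cV[R]_p) :
  measurable_fun setT (fun mu : borelRp R p => mvn_pdf S mu z).
Proof.
apply: measurable_funM => //; apply: measurableT_comp => //.
apply: measurable_funM => //; apply: measurableT_comp => //.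
rewrite (_ : (fun _ => _) = fun mu : borelRp R p =>
  \sum_j (\sum_k (z k 0 - mu k 0) * invmx S k j) * (z j 0 - mu j 0)).
  have mcoord k : measurable_fun setT (fun mu : borelRp R p => z k 0 - mu k 0).
    by apply: measurable_funB => //; exact: measurable_coord.
  apply: measurable_sum => j; apply: measurable_funM => //.
  by apply: measurable_sum => k; exact: measurable_funM.
apply/funext => mu; rewrite mxE; apply: eq_bigr => j _; rewrite !mxE.
by congr (_ * _); apply: eq_bigr => k _; rewrite !mxE.
Qed.

(** A nonpositive determinant would make the square root zero, and with it the
whole density. *)
Lemma mvn_pdf_gt0 (R : realType) (p : nat) (S : 'M[R]_p) (mu z : 'cV[R]_p) :
  posdefmx S -> 0 < mvn_pdf S mu z.
Proof.
move=> S_pd; rewrite mulr_gt0 ?expR_gt0// invr_gt0 sqrtr_gt0.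
by rewrite mulr_gt0 ?posdefmx_det_gt0// exprn_gt0// mulr_gt0// pi_gt0.
Qed.

Lemma mvn_pdf_le (R : realType) (p : nat) (S : 'M[R]_p) (mu z : 'cV[R]_p) :
  posdefmx S -> mvn_pdf S mu z <= (Num.sqrt ((2 * pi) ^+ p * \det S))^-1.
Proof.
move=> S_pd; rewrite ler_piMr ?invr_ge0 ?sqrtr_ge0// -expR0 ler_expR.
by rewrite mulNr oppr_le0 divr_ge0// posdefmx_invmx_ge0.
Qed.

Lemma integrable_mvn_pdf (R : realType) (p : nat) (S : 'M[R]_p)
    (z : 'cV[R]_p) (D : set (borelRp R p)) (Q : probability (borelRp R p) R) :
  posdefmx S -> measurable D ->
  Q.-integrable D (EFin \o (fun mu => mvn_pdf S mu z)).
Proof.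
move=> S_pd mD; apply: measurable_bounded_integrable => //.
- by rewrite (le_lt_trans (probability_le1 Q mD))// ltry.
- by apply: measurable_funTS; exact: measurable_mvn_pdf.
exists (Num.sqrt ((2 * pi) ^+ p * \det S))^-1; split; first exact: num_real.
move=> M M_gt mu _ /=; rewrite ger0_norm ?ltW ?mvn_pdf_gt0//.
exact: le_lt_trans (mvn_pdf_le _ _ S_pd) M_gt.
Qed.

(** * Real-valued integrals *)

Section Rintegral_facts.
Context d (T : measurableType d) (R : realType) (Q : {measure set T -> \bar R}).
Context (D : set T) (mD : measurable D).

Lemma Rintegral_lincomb (n : nat) (a : 'I_n -> R) (f : 'I_n -> T -> R) :
  (forall i, Q.-integrable D (EFin \o f i)) ->
  \int[Q]_(x in D) (\sum_i a i * f i x) = \sum_i a i * \int[Q]_(x in D) f i x.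
Proof.
move=> fi.
have afi i : Q.-integrable D (EFin \o (fun x => a i * f i x)).
  have := integrableZl mD (a i) (fi i); apply: eq_integrable => // x _ /=.
pose F i x : \bar R := (a i * f i x)%:E.
rewrite /Rintegral; under eq_integral do rewrite -sumEFin.
rewrite (@integral_sum _ _ _ Q D mD _ F)//.
rewrite -sum_fine => [|i _]; last first.
  by apply: integrable_fin_num => //; exact: afi.
by apply: eq_bigr => i _; rewrite -RintegralZl.
Qed.

Lemma ae_eq_Rintegral (f g : T -> R) :
  measurable_fun D f -> measurable_fun D g ->
  {ae Q, forall x, D x -> f x = g x} ->
  \int[Q]_(x in D) f x = \int[Q]_(x in D) g x.
Proof.
move=> mf mg fg; congr fine; apply: ae_eq_integral => //.
- exact/measurable_EFinP.
- exact/measurable_EFinP.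
by apply: filterS fg => x fgx Dx; rewrite fgx.
Qed.

Lemma Rintegral_ge0_eq0_ae (f : T -> R) :
  Q.-integrable D (EFin \o f) -> (forall x, D x -> 0 <= f x) ->
  \int[Q]_(x in D) f x = 0 -> {ae Q, forall x, D x -> f x = 0}.
Proof.
move=> fi f_ge0 f0; have mf := measurable_int _ fi.
have : (\int[Q]_(x in D) `|(EFin \o f) x| = 0)%E.
  rewrite (eq_integral (EFin \o f)); last first.
    by move=> x /[!inE] Dx /=; rewrite ger0_norm// f_ge0.
  by rewrite -[LHS]fineK ?integrable_fin_num// -[fine _]/(Rintegral _ _ _) f0.
move/(ae_eq_integral_abs Q mD mf); apply: filterS => x /[apply].
by case.
Qed.

Lemma Rintegral_gt0 (f : T -> R) :
  Q.-integrable D (EFin \o f) -> (forall x, D x -> 0 < f x) ->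
  Q D != 0%E -> 0 < \int[Q]_(x in D) f x.
Proof.
move=> fi f_gt0 QD_neq0; have f_ge0 x : D x -> 0 <= f x by move/f_gt0/ltW.
rewrite lt_neqAle Rintegral_ge0// andbT eq_sym.
apply: contra QD_neq0 => /eqP/(Rintegral_ge0_eq0_ae fi f_ge0)[N [mN N0 DN]].
apply/eqP/(subset_measure0 mD mN _ N0) => x Dx; apply: DN => /= /(_ Dx) fx0.
by have := f_gt0 x Dx; rewrite fx0 ltxx.
Qed.

End Rintegral_facts.

(** * Interpolation on linearly independent vectors *)

(** The matrix whose rows are the vectors has full row rank, hence a right
inverse N, and N b is the required vector of weights. *)
Lemma free_interpolation (F : fieldType) (n K : nat) (V : K.-tuple 'cV[F]_n)
    (b : 'I_K -> F) :
  free V -> exists a : 'I_n -> F, forall j, \sum_i a i * tnth V j i 0 = b j.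
Proof.
move=> /freeP V_free; pose M := \matrix_(j < K, i < n) tnth V j i 0.
have /row_freeP[N MN1] : row_free M.
  apply: inj_row_free => v vM0; apply/rowP => j; rewrite mxE.
  apply: (V_free (v 0)); apply/colP => i; rewrite summxE mxE.
  have /rowP/(_ i) := vM0; rewrite !mxE => vM0i; rewrite -[RHS]vM0i.
  by apply: eq_bigr => k _; rewrite !mxE (tnth_nth 0).
exists (fun i => (N *m \col_j b j) i 0) => j.
have /colP/(_ j) : M *m (N *m \col_j b j) = \col_j b j.
  by rewrite mulmxA MN1 mul1mx.
rewrite mxE [in RHS]mxE => <-.
by apply: eq_bigr => i _; rewrite [M _ _]mxE mulrC.
Qed.

(** * Loglikelihood and gradient of a normal mixture *)

Section mixture_likelihood.
Context (R : realType) (p n : nat).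
Context (y : 'I_n -> 'cV[R]_p) (Omega : set (borelRp R p)) (S : 'M[R]_p).
Context (mOmega : measurable Omega) (S_pd : posdefmx S).
Implicit Types Q : probability (borelRp R p) R.

Lemma mixture_pdf_gt0 Q z : mixing Omega Q -> 0 < mixture_pdf Omega S Q z.
Proof.
move=> Q_mixing; apply: Rintegral_gt0 => //.
- exact: integrable_mvn_pdf.
- by move=> mu _; exact: mvn_pdf_gt0.
by rewrite /= Q_mixing oner_neq0.
Qed.

Lemma Rintegral_pdf_lincomb Q (a : 'I_n -> R) :
  \int[Q]_(mu in Omega) (\sum_i a i * mvn_pdf S mu (y i)) =
  \sum_i a i * mixture_pdf Omega S Q (y i).
Proof.
rewrite (Rintegral_lincomb mOmega _
  (f := fun i (mu : borelRp R p) => mvn_pdf S mu (y i)))//.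
by move=> i; exact: integrable_mvn_pdf.
Qed.

Lemma integrable_pdf_lincomb Q (a : 'I_n -> R) :
  Q.-integrable Omega
    (EFin \o (fun mu => \sum_i a i * mvn_pdf S mu (y i))).
Proof.
rewrite (_ : _ \o _ = fun mu => \sum_i (a i)%:E * (mvn_pdf S mu (y i))%:E)%E.
  apply: integrable_sum => // i _; apply: integrableZl => //.
  exact: integrable_mvn_pdf.
by apply/funext => mu /=; rewrite -sumEFin.
Qed.

Lemma gradientE Q mu : gradient Omega S y Q mu =
  \sum_i (mixture_pdf Omega S Q (y i))^-1 * mvn_pdf S mu (y i) - n%:R.
Proof.
rewrite /gradient sumrB; congr (_ - _); last by rewrite sumr_const card_ord.
by apply: eq_bigr => i _; rewrite mulrC.
Qed.

Lemma integrable_gradient Q Q' :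
  Q'.-integrable Omega (EFin \o gradient Omega S y Q).
Proof.
pose a i := (mixture_pdf Omega S Q (y i))^-1.
pose F (mu : borelRp R p) := \sum_i a i * mvn_pdf S mu (y i).
pose c : R := n%:R.
rewrite (_ : _ \o _ = (EFin \o F) \- cst c%:E)%E.
  apply: integrableB => //; first exact: integrable_pdf_lincomb.
  exact: finite_measure_integrable_cst.
by apply/funext => mu /=; rewrite gradientE EFinB.
Qed.

(** The directional derivative of the loglikelihood at Q towards Q': integrating
over mu replaces f_mu by the mixture density of Q'. *)
Lemma Rintegral_gradient Q Q' : mixing Omega Q' ->
  \int[Q']_(mu in Omega) gradient Omega S y Q mu =
  \sum_i (mixture_pdf Omega S Q' (y i) / mixture_pdf Omega S Q (y i) - 1).
Proof.
move=> Q'_mixing; under eq_Rintegral do rewrite gradientE.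
rewrite RintegralB//; first last.
- exact: finite_measure_integrable_cst.
- exact: integrable_pdf_lincomb.
rewrite Rintegral_cst//= Q'_mixing mulr1 Rintegral_pdf_lincomb sumrB.
congr (_ - _); last by rewrite sumr_const card_ord.
by apply: eq_bigr => i _; rewrite mulrC.
Qed.

Lemma loglikB Q Q' : mixing Omega Q -> mixing Omega Q' ->
  loglik Omega S y Q' - loglik Omega S y Q =
  \sum_i ln (mixture_pdf Omega S Q' (y i) / mixture_pdf Omega S Q (y i)).
Proof.
move=> Q_mixing Q'_mixing; rewrite -sumrB; apply: eq_bigr => i _.
by rewrite ln_div ?posrE ?mixture_pdf_gt0.
Qed.

(** The loglikelihood is concave in the mixing measure, so it lies below its
tangent at Q. *)
Lemma loglikB_le_gradient Q Q' : mixing Omega Q -> mixing Omega Q' ->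
  loglik Omega S y Q' - loglik Omega S y Q <=
  \int[Q']_(mu in Omega) gradient Omega S y Q mu.
Proof.
move=> Q_mixing Q'_mixing; rewrite loglikB// Rintegral_gradient//.
by apply: ler_sum => i _; rewrite ln_le_sub1// divr_gt0// mixture_pdf_gt0.
Qed.

(** Every summand of the inequality ln x <= x - 1 is then an equality, and it is
strict away from x = 1.  The mixture densities at the data are thus determined
even when the mixing measure is not. *)
Lemma loglikB_eq_gradient Q Q' : mixing Omega Q -> mixing Omega Q' ->
  loglik Omega S y Q' - loglik Omega S y Q =
  \int[Q']_(mu in Omega) gradient Omega S y Q mu ->
  forall i, mixture_pdf Omega S Q' (y i) = mixture_pdf Omega S Q (y i).
Proof.
move=> Q_mixing Q'_mixing; rewrite loglikB// Rintegral_gradient//.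
pose r i := mixture_pdf Omega S Q' (y i) / mixture_pdf Omega S Q (y i).
have r_gt0 i : 0 < r i by rewrite divr_gt0// mixture_pdf_gt0.
move=> sum_eq i; apply/eqP; rewrite -[_ == _]negbK; apply/negP => g_neq.
have : r i - 1 - ln (r i) = 0.
  apply: (@psumr_eq0P _ _ xpredT (fun i => r i - 1 - ln (r i))) => // [k _|].
    by rewrite subr_ge0 ln_le_sub1.
  by rewrite sumrB -sum_eq subrr.
apply/eqP; rewrite gt_eqF// subr_gt0 ln_lt_sub1//.
by apply: contra g_neq => /eqP/divr1_eq ->.
Qed.

Lemma ae_gradient_eq0 Q Q' :
  (forall mu, Omega mu -> gradient Omega S y Q mu <= 0) ->
  \int[Q']_(mu in Omega) gradient Omega S y Q mu = 0 ->
  {ae Q', forall mu, Omega mu -> gradient Omega S y Q mu = 0}.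
Proof.
move=> grad_le0 int0.
have grad_int := integrable_gradient Q Q'.
have opp_int : Q'.-integrable Omega
    (EFin \o (fun mu => -1 * gradient Omega S y Q mu)).
  by have := integrableZl mOmega (-1) grad_int; exact: eq_integrable.
have opp_ge0 mu : Omega mu -> 0 <= -1 * gradient Omega S y Q mu.
  by move=> /grad_le0; rewrite mulN1r oppr_ge0.
have : \int[Q']_(mu in Omega) (-1 * gradient Omega S y Q mu) = 0.
  by rewrite RintegralZl// int0 mulr0.
move/(Rintegral_ge0_eq0_ae mOmega opp_int opp_ge0).
apply: filterS => mu /[apply] /eqP.
by rewrite mulN1r oppr_eq0 => /eqP.
Qed.

(** The weights a interpolate the indicator of A on a set carrying Q, so the
mass of A is read off from the mixture densities at the data alone. *)
Lemma mixing_mass_lincomb Q (K : nat) (mus : 'I_K -> 'cV[R]_p)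
    (a : 'I_n -> R) (A : set (borelRp R p)) :
  mixing Omega Q -> measurable A ->
  {ae Q, forall mu, Omega mu -> range mus mu} ->
  (forall j, \sum_i a i * mvn_pdf S (mus j) (y i) = \1_A (mus j)) ->
  Q A = (\sum_i a i * mixture_pdf Omega S Q (y i))%:E.
Proof.
move=> Q_mixing mA Q_mus aA; rewrite -Rintegral_pdf_lincomb.
rewrite (@ae_eq_Rintegral _ _ _ _ _ mOmega _ (\1_A))//; first last.
- by apply: filterS Q_mus => mu + Omega_mu => /(_ Omega_mu)[j _ <-].
- apply/measurable_EFinP; exact: (measurable_int _ (integrable_pdf_lincomb Q a)).
rewrite /Rintegral integral_indic// fineK ?fin_num_measure//; last first.
  exact: measurableI.
have QC0 : Q (~` Omega) = 0%E.
  by rewrite probability_setC//= Q_mixing subee.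
rewrite (measureDI Q mA mOmega) (subset_measure0 _ (measurableC mOmega))//.
- by rewrite add0e.
- exact: measurableD.
Qed.

End mixture_likelihood.

Theorem theorem8 (R : realType) (p n : nat) (y : 'I_n -> 'cV[R]_p)
    (y_distinct : injective y)
    (Omega : set (borelRp R p)) (mOmega : measurable Omega)
    (S : 'M[R]_p) (S_pd : posdefmx S)
    (Qhat : probability (borelRp R p) R) (Qhat_mixing : mixing Omega Qhat)
    (gradient_le0 : forall mu, Omega mu -> gradient Omega S y Qhat mu <= 0) :
  is_NPMLE Omega S y Qhat /\
  (forall (K : nat) (mus : 'I_K -> 'cV[R]_p),
     (K <= n)%N ->
     [set mu | Omega mu /\ gradient Omega S y Qhat mu = 0] = range mus ->
     free [tuple pdf_vec S y (mus j) | j < K] ->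
     is_unique_NPMLE Omega S y Qhat).
Proof.
have int_le0 Q : mixing Omega Q ->
    \int[Q]_(mu in Omega) gradient Omega S y Qhat mu <= 0.
  move=> Q_mixing.
  rewrite -[leRHS](_ : \int[Q]_(mu in Omega) 0 = 0); last first.
    by rewrite Rintegral_cst// mul0r.
  apply: le_Rintegral => //; first exact: integrable_gradient.
  exact: integrable0.
have Qhat_max : is_NPMLE Omega S y Qhat.
  split=> // Q Q_mixing; rewrite -subr_le0.
  exact: le_trans (loglikB_le_gradient _ _ _ _ _) (int_le0 _ _).
split=> // K mus _ musE mus_free; split=> // Q [Q_mixing Q_max] A mA.
have loglikQ : loglik Omega S y Q - loglik Omega S y Qhat = 0.
  apply/eqP; rewrite subr_eq0 eq_le Q_max// andbT.
  by case: Qhat_max => _; exact.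
have intQ0 : \int[Q]_(mu in Omega) gradient Omega S y Qhat mu = 0.
  apply/eqP; rewrite eq_le int_le0//= -loglikQ.
  exact: loglikB_le_gradient.
have intQhat0 : \int[Qhat]_(mu in Omega) gradient Omega S y Qhat mu = 0.
  rewrite Rintegral_gradient// big1// => i _.
  by rewrite divff ?subrr// gt_eqF// mixture_pdf_gt0.
have pdfE i : mixture_pdf Omega S Q (y i) = mixture_pdf Omega S Qhat (y i).
  by apply: loglikB_eq_gradient => //; rewrite intQ0.
have ae_mus Q' : mixing Omega Q' ->
    \int[Q']_(mu in Omega) gradient Omega S y Qhat mu = 0 ->
    {ae Q', forall mu, Omega mu -> range mus mu}.
  move=> Q'_mixing /(ae_gradient_eq0 mOmega S_pd gradient_le0).
  by apply: filterS => mu grad0 Omega_mu; rewrite -musE; split=> //; exact: grad0.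
have [a aE] := free_interpolation (fun j => \1_A (mus j)) mus_free.
have {}aE j : \sum_i a i * mvn_pdf S (mus j) (y i) = \1_A (mus j).
  by rewrite -[RHS]aE; apply: eq_bigr => i _; rewrite tnth_mktuple mxE.
rewrite (mixing_mass_lincomb mOmega S_pd Q_mixing mA _ aE).
  rewrite (mixing_mass_lincomb mOmega S_pd Qhat_mixing mA _ aE).
    by congr EFin; apply: eq_bigr => i _; rewrite pdfE.
  exact: ae_mus.
exact: ae_mus.
Qed.
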